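(* Let $P$ be a standard, range-restricted logic program in which, whenever a variable $X$ occurs both in a term of the head and in a term of the body of a rule, at most one of these two terms is complex, and every complex term has nesting depth at most one. Then: (1) every argument in $\mathit{GA}(P)$ is limited; (2) if $P$ is $\Gamma$-acyclic, then $P$ is finitely ground.
   Context: Terms are constants, variables (simple terms) or $f(t_1,\dots,t_m)$ with $f$ a function symbol of arity $m$ (complex terms). An atom is $p(t_1,\dots,t_n)$. A standard rule has the form $A\leftarrow B_1,\dots,B_k$ ($k\ge 0$, all atoms); a standard program is a finite set of such rules; range-restricted means every head variable occurs in the body. Predicates are base (defined only by ground facts) or derived. For an $n$-ary predicate $p$, $p[i]$ ($1\le i\le n$) is its $i$-th argument; $args(P)$ is the set of all arguments. A standard program has a unique minimum model $M$; the active domain of $p[i]$ is $AD(p[i])=\{t_i\mid p(t_1,\dots,t_n)\in M\}$, and $p[i]$ is limited iff $AD(p[i])$ is finite. Depth: for a simple term $u$ occurring in $t$, $d(u,u)=0$ and $d(u,f(t_1,\dots,t_m))=1+\max_{i:\,t_i\text{ contains }u}d(u,t_i)$. Restricted arguments: for a function $\phi:args(P)\to\mathbb N$ define $\Omega(\phi)(p[i])=\max(\max\{D(r,i,X)\},0)$, the inner max over rules $r\in P$ with head $p(t_1,\dots,t_n)$ and variables $X$ occurring in $t_i$, where $D(r,i,X)=\min\{d(X,t_i)-d(X,u_j)+\phi(q[j])\mid q(u_1,\dots,u_m)\text{ a body atom of }r,\ X\text{ occurs in }u_j\}$. Let $\phi_0\equiv 0$. The sequence $\Omega^k(\phi_0)(p[i])$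 is nondecreasing in $k$; $AR(P)$ is the set of arguments $p[i]$ for which this sequence is eventually constant. Labeled argument graph $\mathcal G_L(P)$: nodes $args(P)$; for every rule $r$ with head $p(v_1,\dots,v_n)$, body atom $q(u_1,\dots,u_m)$, and a variable $X$ common to $u_j$ and $v_i$, there is an edge $(q[j],p[i],\alpha)$ with $\alpha=\epsilon$ if $u_j=v_i=X$; $\alpha=f$ if $u_j=X$ and $v_i=f(\dots,X,\dots)$; $\alpha=\overline f$ if $u_j=f(\dots,X,\dots)$ and $v_i=X$. For a path $\pi$ (nonempty sequence of consecutive edges), $\lambda(\pi)$ is the concatenation of its labels ($\epsilon$ is the empty string); $\pi$ spells $\lambda(\pi)$. Let $F_P$ be the set of function symbols of $P$, $\overline F_P=\{\overline f\mid f\in F_P\}$. The grammar $\Gamma_P$ has terminals $F_P\cup\overline F_P$, nonterminals $S,S_1,S_2$, start $S$, and productions $S\to S_1 f S_2$, $S_1\to f S_1\overline f S_1\mid\epsilon$, $S_2\to S_1S_2\mid fS_2\mid\epsilon$ for all $f\in F_P$; $\mathcal L(\Gamma_P)$ is its language. The propagation graph $\Delta(P)$ is $\mathcal G_L(P)$ with all edges ending in a node of $AR(P)$ removed. A node $a$ depends on a node $b$ if there is a path from $b$ to $a$; it depends on a cyclic path if it depends on some node of it (nodes on the cycle depend on it). $\mathit{GA}(P)$ is the set of arguments not depending on any cyclic path of $\Delta(P)$ spelling a string of $\mathcal L(\Gamma_P)$; $P$ is $\Gamma$-acyclic iff $\mathit{GA}(P)=args(P)$. Finitely ground (Calimeri,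 Cozza, Ianni, Leone 2008): $P$ is finitely ground if, for every topological ordering of the components of its predicate dependency graph, the intelligent instantiation of $P$ along that ordering (processing components in order, and for each component iteratively adding exactly those ground instances of its rules whose body atoms have already been derived as heads of previously added ground rules or facts) is finite; this instantiation has the same stable models as $P$. *)

(* Defs.v *)
(* MathComp, with the classical sets of MathComp-Analysis. *)
From HB Require Import structures.
From mathcomp Require Import all_boot all_order all_algebra.
From mathcomp Require Import boolp classical_sets cardinality.

Set Implicit Arguments.
Unset Strict Implicit.
Unset Printing Implicit Defensive.

Local Open Scope classical_set_scope.

Record signature := Signature {
  var : eqType;
  con : eqType;
  fsym : eqType;
  psym : eqType;
  farity : fsym -> nat;
  parity : psym -> nat;
  farity_gt0 : forall f, 0 < farity f }.

Section Terms.
Variable Sg : signature.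

(* Arities are not enforced by the type; see [wf_term]. *)
Inductive term :=
| TVar of var Sg
| TCon of con Sg
| TApp of fsym Sg & seq term.

Fixpoint term_code (t : term) : GenTree.tree (var Sg + con Sg + fsym Sg) :=
  match t with
  | TVar x => GenTree.Leaf (inl (inl x))
  | TCon c => GenTree.Leaf (inl (inr c))
  | TApp f ts => GenTree.Node 0 (GenTree.Leaf (inr f) :: map term_code ts)
  end.

Fixpoint term_decode (c : GenTree.tree (var Sg + con Sg + fsym Sg)) :
    option term :=
  match c with
  | GenTree.Leaf (inl (inl x)) => Some (TVar x)
  | GenTree.Leaf (inl (inr c)) => Some (TCon c)
  | GenTree.Node 0 (GenTree.Leaf (inr f) :: cs) =>
      Some (TApp f (pmap id (map term_decode cs)))
  | _ => None
  end.

Lemma term_codeK : pcancel term_code term_decode.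
Proof.
rewrite /pcancel; fix IH 1 => -[x|c|f ts] //=; congr (Some (TApp f _)).
by elim: ts => //= t ts ->; rewrite IH.
Qed.

HB.instance Definition _ := Equality.copy term (pcan_type term_codeK).

Definition is_complex (t : term) : bool := if t is TApp _ _ then true else false.

(* The simple terms (variables and constants) occurring in t. *)
Fixpoint simples (t : term) : seq term :=
  match t with
  | TApp _ ts => flatten (map simples ts)
  | _ => [:: t]
  end.

Definition vars (t : term) : seq (var Sg) :=
  pmap (fun u => if u is TVar x then Some x else None) (simples t).

Definition consts (t : term) : seq (con Sg) :=
  pmap (fun u => if u is TCon c then Some c else None) (simples t).

Fixpoint fsyms (t : term) : seq (fsym Sg) :=
  if t is TApp f ts then f :: flatten (map fsyms ts) else [::].

Fixpoint wf_term (t : term) : bool :=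
  if t is TApp f ts then (size ts == farity f) && all wf_term ts else true.

(* d(u, t); meaningful only if the simple term u occurs in t. *)
Fixpoint depth (u t : term) : nat :=
  if t is TApp _ ts then
    (foldr (fun t' m => if u \in simples t' then maxn (depth u t') m else m)
       0 ts).+1
  else 0.

Definition nesting_depth (t : term) : nat := \max_(u <- simples t) depth u t.

Fixpoint subst (s : var Sg -> term) (t : term) : term :=
  match t with
  | TVar x => s x
  | TCon c => TCon c
  | TApp f ts => TApp f (map (subst s) ts)
  end.

Record atom := Atom { apred : psym Sg; aargs : seq term }.

Lemma atomK :
  cancel (fun a => (apred a, aargs a)) (fun p => Atom p.1 p.2).
Proof. by case. Qed.

HB.instance Definition _ := Equality.copy atom (can_type atomK).

Record rule := Rule { rhead : atom; rbody : seq atom }.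

Lemma ruleK :
  cancel (fun r => (rhead r, rbody r)) (fun p => Rule p.1 p.2).
Proof. by case. Qed.

HB.instance Definition _ := Equality.copy rule (can_type ruleK).

Definition program := seq rule.

Definition wf_atom (a : atom) : bool :=
  (size (aargs a) == parity (apred a)) && all wf_term (aargs a).

Definition wf_rule (r : rule) : bool := all wf_atom (rhead r :: rbody r).

Definition subst_atom (s : var Sg -> term) (a : atom) : atom :=
  Atom (apred a) (map (subst s) (aargs a)).

Definition subst_rule (s : var Sg -> term) (r : rule) : rule :=
  Rule (subst_atom s (rhead r)) (map (subst_atom s) (rbody r)).

Definition rule_terms (r : rule) : seq term :=
  flatten (map aargs (rhead r :: rbody r)).

Definition head_vars (r : rule) : seq (var Sg) :=
  flatten (map vars (aargs (rhead r))).

Definition body_vars (r : rule) : seq (var Sg) :=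
  flatten (map vars (flatten (map aargs (rbody r)))).

Definition rule_vars (r : rule) : seq (var Sg) := head_vars r ++ body_vars r.

(* (p, i) stands for the argument p[i], with i counted from 0. *)
Definition argument := (psym Sg * nat)%type.

(* The pairs (p[i], t_i) for the atom p(t_0, ..., t_{n-1}). *)
Definition arg_terms (a : atom) : seq (argument * term) :=
  zip [seq (apred a, i) | i <- iota 0 (size (aargs a))] (aargs a).

Definition body_arg_terms (r : rule) : seq (argument * term) :=
  flatten (map arg_terms (rbody r)).

End Terms.

Section Programs.
Variables (Sg : signature) (P : program Sg).

Definition wf_program : bool := all (@wf_rule Sg) P.

Definition range_restricted : Prop :=
  forall r, r \in P -> {subset head_vars r <= body_vars r}.

Definition one_complex_side : Prop :=
  forall r, r \in P ->
  forall t, t \in aargs (rhead r) ->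
  forall b u, b \in rbody r -> u \in aargs b ->
  forall X, X \in vars t -> X \in vars u -> ~~ (is_complex t && is_complex u).

Definition depth_at_most_one : Prop :=
  forall r t, r \in P -> t \in rule_terms r -> is_complex t ->
  nesting_depth t <= 1.

Definition program_terms : seq (term Sg) :=
  flatten (map (@rule_terms Sg) P).

Definition program_consts : seq (con Sg) :=
  flatten (map (@consts Sg) program_terms).

Definition program_fsyms : seq (fsym Sg) :=
  flatten (map (@fsyms Sg) program_terms).

Definition program_psyms : seq (psym Sg) :=
  flatten [seq map (@apred Sg) (rhead r :: rbody r) | r <- P].

Definition args : set (argument Sg) :=
  [set a | a.1 \in program_psyms /\ a.2 < parity a.1].

Definition base_pred (p : psym Sg) : bool :=
  all (fun r => (apred (rhead r) == p) ==> nilp (rbody r) && nilp (rule_vars r))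
    P.

Definition derived_pred (p : psym Sg) : bool :=
  (p \in program_psyms) && ~~ base_pred p.

Inductive herbrand_universe : term Sg -> Prop :=
| herbrand_con c : c \in program_consts -> herbrand_universe (TCon c)
| herbrand_app f ts : f \in program_fsyms -> size ts = farity f ->
    (forall t, t \in ts -> herbrand_universe t) ->
    herbrand_universe (TApp f ts).

Definition herbrand_base : set (atom Sg) :=
  [set a | [/\ apred a \in program_psyms, size (aargs a) = parity (apred a)
             & forall t, t \in aargs a -> herbrand_universe t]].

(* Only the values on the variables of r matter: a variable-free rule has a
   ground instance even if the Herbrand universe is empty. *)
Definition grounding (r : rule Sg) (s : var Sg -> term Sg) : Prop :=
  forall X, X \in rule_vars r -> herbrand_universe (s X).

Definition herbrand_model (I : set (atom Sg)) : Prop :=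
  I `<=` herbrand_base /\
  forall r s, r \in P -> grounding r s ->
    (forall b, b \in rbody (subst_rule s r) -> I b) ->
    I (rhead (subst_rule s r)).

Definition minimum_model : set (atom Sg) :=
  \bigcap_(I in herbrand_model) I.

Lemma herbrand_base_model : wf_program -> herbrand_model herbrand_base.
Proof.
move=> wfP; split=> // r s rP gs _.
have hd_in : {subset aargs (rhead r) <= program_terms}.
  move=> t tr; apply/flattenP; exists (rule_terms r); first by apply: map_f.
  by apply/flattenP; exists (aargs (rhead r)) => //=; rewrite inE eqxx.
have [/eqP sz /allP wft] : size (aargs (rhead r)) == parity (apred (rhead r)) /\
    all (@wf_term Sg) (aargs (rhead r)).
  by apply/andP; move/allP: wfP => /(_ _ rP); rewrite /wf_rule /= => /andP[].
split=> /=.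
- by apply/flattenP; eexists; [apply: (map_f _ rP)| rewrite /= inE eqxx].
- by rewrite size_map.
move=> _ /mapP[t tr ->].
have H1 : {subset vars t <= rule_vars r}.
  move=> x xt; rewrite /rule_vars mem_cat; apply/orP; left.
  by apply/flattenP; exists (vars t) => //; apply: map_f.
have H2 : {subset consts t <= program_consts}.
  move=> x xt; apply/flattenP; exists (consts t) => //.
  by apply: map_f; apply: hd_in.
have H3 : {subset fsyms t <= program_fsyms}.
  move=> x xt; apply/flattenP; exists (fsyms t) => //.
  by apply: map_f; apply: hd_in.
move: (wft _ tr) H1 H2 H3; clear tr.
move: t; fix IH 1 => -[x|c|f ts] /=.
- by move=> _ H1 _ _; apply: gs; apply: H1; rewrite inE.
- by move=> _ _ H _; constructor; apply: H; rewrite inE.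
case/andP=> /eqP sz' wts H1 H2 H3; constructor.
- by apply: H3; rewrite inE eqxx.
- by rewrite size_map.
have {}H3 : {subset flatten (map (@fsyms Sg) ts) <= program_fsyms}.
  by move=> g gi; apply: H3; rewrite inE gi orbT.
rewrite /vars /consts /= in H1 H2.
elim: ts wts H1 H2 H3 {sz'} => //= t ts IHts /andP[wt wts] H1 H2 H3 u.
rewrite inE => /orP[/eqP->|].
  apply: IH => //.
  - by move=> x xi; apply: H1; rewrite pmap_cat mem_cat; apply/orP; left.
  - by move=> x xi; apply: H2; rewrite pmap_cat mem_cat; apply/orP; left.
  - by move=> x xi; apply: H3; rewrite mem_cat xi.
apply: IHts => //.
- by move=> x xi; apply: H1; rewrite pmap_cat mem_cat xi orbT.
- by move=> x xi; apply: H2; rewrite pmap_cat mem_cat xi orbT.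
- by move=> x xi; apply: H3; rewrite mem_cat xi orbT.
Qed.

Lemma minimum_model_model : wf_program -> herbrand_model minimum_model.
Proof.
move=> wfP; split; first by move=> a; apply; exact: herbrand_base_model.
move=> r s rP gs H I mI; case: (mI) => _; apply=> // b /H; exact.
Qed.

Lemma minimum_model_min I : herbrand_model I -> minimum_model `<=` I.
Proof. by move=> mI a; apply. Qed.

Definition active_domain (a : argument Sg) : set (term Sg) :=
  [set t | exists2 A, minimum_model A & (a, t) \in arg_terms A].

Definition limited (a : argument Sg) : Prop := finite_set (active_domain a).

(* [minD phi r t X] is D(r, i, X), with t the i-th argument of the head of r.
   The list of candidates is nonempty when r is range-restricted and X occurs
   in t; its head only serves as the unit of the iterated minimum. *)
Definition minD (phi : argument Sg -> nat) (r : rule Sg) (t : term Sg)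
    (X : var Sg) : int :=
  let cands := [seq ((depth (TVar X) t)%:Z - (depth (TVar X) qu.2)%:Z
                     + (phi qu.1)%:Z)%R
               | qu <- body_arg_terms r & X \in vars qu.2] in
  (\big[Order.min/head 0 cands]_(z <- cands) z)%R.

(* The unit 0 of the iterated maxima accounts for max(..., 0); the result is
   hence nonnegative and [absz] is a mere cast. *)
Definition Omega (phi : argument Sg -> nat) (a : argument Sg) : nat :=
  absz (\big[Order.max/0]_(r <- P)
        \big[Order.max/0]_(pt <- arg_terms (rhead r) | pt.1 == a)
        \big[Order.max/0]_(X <- vars pt.2) minD phi r pt.2 X)%R.

Definition AR : set (argument Sg) :=
  [set a | args a /\ exists K, forall k, K <= k ->
             iter k Omega (fun=> 0) a = iter K Omega (fun=> 0) a].

End Programs.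

Inductive letter (F : Type) := Sym of F | Bar of F.

Section Grammar.
Variables (F : eqType) (FP : seq F).

Definition word := seq (letter F).

(* The strings derivable from the nonterminals S1, S2 and S. *)
Inductive gen_S1 : word -> Prop :=
| gen_S1_wrap f u v : f \in FP -> gen_S1 u -> gen_S1 v ->
    gen_S1 ([:: Sym f] ++ u ++ [:: Bar f] ++ v)
| gen_S1_nil : gen_S1 [::].

Inductive gen_S2 : word -> Prop :=
| gen_S2_cat u v : gen_S1 u -> gen_S2 v -> gen_S2 (u ++ v)
| gen_S2_sym f v : f \in FP -> gen_S2 v -> gen_S2 ([:: Sym f] ++ v)
| gen_S2_nil : gen_S2 [::].

Inductive gen_S : word -> Prop :=
| gen_S_intro f u v : f \in FP -> gen_S1 u -> gen_S2 v ->
    gen_S (u ++ [:: Sym f] ++ v).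

End Grammar.

Section Graphs.
Variable Sg : signature.

Record edge := Edge {
  esrc : argument Sg;
  edst : argument Sg;
  elab : word (fsym Sg) }.

Definition consecutive (e e' : edge) : bool := edst e == esrc e'.

Fixpoint all_in (G : set edge) (pi : seq edge) : Prop :=
  if pi is e :: pi' then G e /\ all_in G pi' else True.

Definition path_from_to (G : set edge) (a b : argument Sg) (pi : seq edge) :
    Prop :=
  if pi is e :: pi' then
    [/\ esrc e = a, edst (last e pi') = b, path consecutive e pi'
      & all_in G pi]
  else False.

Definition spelled (pi : seq edge) : word (fsym Sg) := flatten (map elab pi).

Definition path_nodes (pi : seq edge) : seq (argument Sg) :=
  map esrc pi ++ map edst pi.

Definition cyclic_path (G : set edge) (pi : seq edge) : Prop :=
  exists a, path_from_to G a a pi.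

Definition depends_on (G : set edge) (a b : argument Sg) : Prop :=
  exists pi, path_from_to G b a pi.

Definition depends_on_path (G : set edge) (a : argument Sg) (pi : seq edge) :
    Prop :=
  exists2 b, b \in path_nodes pi & depends_on G a b.

End Graphs.

Section Gamma.
Variables (Sg : signature) (P : program Sg).

Inductive edge_label (X : var Sg) : term Sg -> term Sg -> word (fsym Sg) -> Prop :=
| label_eps : edge_label X (TVar X) (TVar X) [::]
| label_sym f vs : TVar X \in vs ->
    edge_label X (TVar X) (TApp f vs) [:: Sym f]
| label_bar f us : TVar X \in us ->
    edge_label X (TApp f us) (TVar X) [:: Bar f].

Definition labeled_argument_graph : set (edge Sg) :=
  [set e | exists r X u v,
     [/\ r \in P, (esrc e, u) \in body_arg_terms r,
         (edst e, v) \in arg_terms (rhead r) & edge_label X u v (elab e)]].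

Definition propagation_graph : set (edge Sg) :=
  [set e | labeled_argument_graph e /\ ~ AR P (edst e)].

Definition Gamma_language : set (word (fsym Sg)) := gen_S (program_fsyms P).

Definition GA : set (argument Sg) :=
  [set a | args P a /\
     ~ exists pi, [/\ cyclic_path propagation_graph pi,
                      Gamma_language (spelled pi)
                    & depends_on_path propagation_graph a pi]].

Definition Gamma_acyclic : Prop := GA = args P.

End Gamma.

Section FinitelyGround.
Variables (Sg : signature) (P : program Sg).

(* As in Calimeri et al., the nodes of the predicate dependency graph are the
   derived predicates; the facts of base predicates are available from the
   start. *)
Definition dep_edge (p q : psym Sg) : bool :=
  [&& derived_pred P p, derived_pred P q &
      has (fun r => (apred (rhead r) == q) && (p \in map (@apred Sg) (rbody r)))
        P].

Definition dep_reach (p q : psym Sg) : Prop :=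
  exists2 s, path dep_edge p s & last p s = q.

Definition component (C : set (psym Sg)) : Prop :=
  exists2 p, derived_pred P p &
    C = [set q | [/\ derived_pred P q, dep_reach p q & dep_reach q p]].

Definition topological_ordering (Cs : seq (set (psym Sg))) : Prop :=
  [/\ uniq Cs, forall C, C \in Cs <-> component C
    & forall i j p q, i < size Cs -> j < size Cs ->
        nth set0 Cs i p -> nth set0 Cs j q -> dep_edge p q -> i <= j].

Definition heads (S : set (rule Sg)) : set (atom Sg) := [set rhead g | g in S].

(* The ground instances of the rules defining predicates of C whose body atoms
   are heads of S. *)
Definition restricted_instances (C : set (psym Sg)) (S : set (rule Sg)) :
    set (rule Sg) :=
  [set g | exists r s,
     [/\ r \in P, C (apred (rhead r)), grounding P r s, g = subst_rule s r
       & forall b, b \in rbody g -> heads S b]].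

Definition component_instantiation (S : set (rule Sg)) (C : set (psym Sg)) :
    set (rule Sg) :=
  \bigcup_k iter k (fun X => X `|` restricted_instances C (S `|` X)) set0.

Definition base_facts : set (rule Sg) :=
  [set r | r \in P /\ base_pred P (apred (rhead r))].

Definition intelligent_instantiation (Cs : seq (set (psym Sg))) :
    set (rule Sg) :=
  foldl (fun S C => S `|` component_instantiation S C) base_facts Cs.

Definition finitely_ground : Prop :=
  forall Cs, topological_ordering Cs -> finite_set (intelligent_instantiation Cs).

End FinitelyGround.

(* Main.v *)
(** A minimum-model term is built along derivations, so each branch of a term
    at the argument [a] is a stack transported along the edges of the labeled
    argument graph: a label f pushes on it and a label \bar f pops from it.
    Arguments in AR(P) hold terms of bounded height, since a late iterate of
    Omega bounds the height on AR(P); a branch may therefore be followed back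
    inside the propagation graph down to a stack of bounded size.  Above that
    size, every symbol left on the stack comes from a push that is never
    popped, so the paths between the sources of two such pushes spell words of
    L(Gamma).  When the branch is longer than the number of arguments, two of
    these sources coincide and [a] depends on a cycle spelling such a word.
    Hence heights are bounded on GA(P).  If GA(P) is everything, the minimum
    model is finite, and the intelligent instantiation consists of rule
    instances whose head and body lie in it. *)
Require Import Defs.
From mathcomp Require Import all_boot.
From mathcomp Require Import boolp classical_sets cardinality.
From mathcomp Require Import all_order all_algebra zify.
(* ssrfun shadows [fsym]. *)
Import Defs.

Set Implicit Arguments.
Unset Strict Implicit.
Unset Printing Implicit Defensive.

Local Open Scope classical_set_scope.

(** * Balanced words and words with unmatched symbols *)

Section Grammar.
Variables (F : eqType) (FP : seq F).
Implicit Types u v w : word F.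

(** S1 generates the balanced words; the production f S1 \bar f S1 ends with an S1, and [v] is
    appended there. *)
Lemma gen_S1_cat u v : gen_S1 FP u -> gen_S1 FP v -> gen_S1 FP (u ++ v).
Proof.
move=> gu gv; elim: gu => // {u} f u w fP gu _ _ IHw.
by have:= gen_S1_wrap fP gu IHw; rewrite /= -!catA /= -?catA.
Qed.

Lemma gen_S1_S2 u : gen_S1 FP u -> gen_S2 FP u.
Proof. by move=> gu; rewrite -[u]cats0; apply: gen_S2_cat gu (gen_S2_nil _). Qed.

Lemma gen_S2_append u v : gen_S2 FP u -> gen_S2 FP v -> gen_S2 FP (u ++ v).
Proof.
move=> gu gv; elim: gu => // {u} [u w gu _|f w fP _] IHw.
  by rewrite -catA; apply: gen_S2_cat.
exact: gen_S2_sym fP IHw.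
Qed.

Lemma gen_S_S2 u : gen_S FP u -> gen_S2 FP u.
Proof.
by case=> f {}u v fP gu gv; apply: gen_S2_cat => //; apply: gen_S2_sym.
Qed.

(** The final S2 in the production of S absorbs any further S2 word. *)
Lemma gen_S_cat u v : gen_S FP u -> gen_S2 FP v -> gen_S FP (u ++ v).
Proof.
case=> f {}u w fP gu gw gv; rewrite -!catA.
by apply: gen_S_intro => //; apply: gen_S2_append.
Qed.

(* [opens w c]: reducing w by f \bar f = epsilon leaves the unmatched symbols
   c, the last one first. *)
Inductive opens : word F -> seq F -> Prop :=
| opens_nil w : gen_S1 FP w -> opens w [::]
| opens_cons w c f v : opens w c -> f \in FP -> gen_S1 FP v ->
    opens (w ++ Sym f :: v) (f :: c).

Lemma opens_sym w c f : opens w c -> f \in FP -> opens (w ++ [:: Sym f]) (f :: c).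
Proof. by move=> wc fP; apply: opens_cons wc fP (gen_S1_nil _). Qed.

(** The popped symbol is the last unmatched one. With the balanced word [v] after it, it forms the
    balanced factor f v \bar f, which merges with the balanced word before it. *)
Lemma opens_bar w c f : opens w (f :: c) -> opens (w ++ [:: Bar f]) c.
Proof.
move E: (f :: c) => fc wfc; case: wfc E => // {w fc} w c' g v wc' gP gv [-> ->].
have gb : gen_S1 FP ([:: Sym g] ++ v ++ [:: Bar g] ++ [::]).
  exact: gen_S1_wrap (gen_S1_nil _).
rewrite -catA; case: wc' => {w c'} [w gw|w c' h v' wc' hP gv'].
  by apply: opens_nil; apply: gen_S1_cat.
by rewrite -catA; apply: opens_cons => //; apply: gen_S1_cat gv' gb.
Qed.

Lemma opens_S2 w c : opens w c -> gen_S2 FP w.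
Proof.
elim=> {w c} [w /gen_S1_S2//|w c f v _ IHw fP /gen_S1_S2 gv].
exact: gen_S2_append IHw (gen_S2_sym fP gv).
Qed.

End Grammar.

(** * Concatenation of paths *)

Section Paths.
Variable Sg : signature.
Implicit Types (G : set (edge Sg)) (a b c : argument Sg).

Lemma all_in_cat G pi pi' : all_in G (pi ++ pi') <-> all_in G pi /\ all_in G pi'.
Proof. by elim: pi => [|e pi IH] /=; tauto. Qed.

Lemma path_from_to_cat G a b c pi pi' :
  path_from_to G a b pi -> path_from_to G b c pi' ->
  path_from_to G a c (pi ++ pi').
Proof.
case: pi => //= e pi [ea eb p1 [Ge G1]]; case: pi' => //= e' pi' [e'b e'c p2 [Ge' G2]].
split=> //; first by rewrite last_cat.
  by rewrite cat_path p1 /= p2 /consecutive eb e'b eqxx.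
by split=> //; apply/all_in_cat.
Qed.

Lemma path_from_to_edge G e : G e -> path_from_to G (esrc e) (edst e) [:: e].
Proof. by []. Qed.

Lemma spelled_cat (pi pi' : seq (edge Sg)) :
  spelled (pi ++ pi') = spelled pi ++ spelled pi'.
Proof. by rewrite /spelled map_cat flatten_cat. Qed.

End Paths.

(** * Heights, branches and terms of nesting depth at most one *)

Section Terms.
Variable Sg : signature.
Implicit Types (t u : term Sg) (s : var Sg -> term Sg).

Fixpoint height t : nat :=
  if t is TApp _ ts then (foldr (fun t' m => maxn (height t') m) 0 ts).+1
  else 0.

Lemma height_app f ts n :
  (height (TApp f ts) <= n.+1) = all (fun t => height t <= n) ts.
Proof. by rewrite /= ltnS; elim: ts => //= t ts <-; rewrite geq_max. Qed.

(** [c] lists the function symbols met from the root downwards, along a path that may stop before a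
    leaf; the alternative [c' = [::]] lets it stop at any application. *)
Fixpoint branch (c : seq (fsym Sg)) t : Prop :=
  if c is f :: c' then
    if t is TApp g ts then f = g /\ (c' = [::] \/ exists2 t', t' \in ts & branch c' t')
    else False
  else True.

Lemma height_branch t n : n <= height t -> exists2 c, branch c t & size c = n.
Proof.
elim: n t => [|n IH] t; first by exists [::].
case: t => // f ts; rewrite /= ltnS => nts.
have [->|n0] := posnP n; first by exists [:: f] => //; split=> //; left.
have [t tts /IH[c ct sc]] : exists2 t, t \in ts & n <= height t.
  elim: ts nts => [|t ts IHts] /=; first by rewrite leqNgt n0.
  rewrite leq_max => /orP[nt|/IHts[t' t'ts nt']].
    by exists t => //; rewrite inE eqxx.
  by exists t' => //; rewrite inE t'ts orbT.
by exists (f :: c); rewrite /= ?sc //; split=> //; right; exists t.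
Qed.

Lemma size_branch c t : branch c t -> size c <= height t.
Proof.
elim: c t => //= f c IH [] // g ts [_ [->//|[t' t'ts ct']]].
have := leqnn (height (TApp g ts)); rewrite {2}[height _]/= height_app.
by move/allP/(_ _ t'ts) => /(leq_trans (IH _ ct')).
Qed.

Definition flat t : bool :=
  if t is TApp _ ts then all (fun t' => ~~ is_complex t') ts else true.

Lemma simples_nil t : wf_term t -> simples t != [::].
Proof.
move: t; fix IH 1 => -[x|c|f [|t ts]] //= /andP[/eqP].
  by have := farity_gt0 f => /[swap] <-.
by move=> _ /andP[/IH]; case: (simples t).
Qed.

Lemma simples_vars X t : (X \in vars t) = (TVar X \in simples t).
Proof.
rewrite /vars; elim: (simples t) => //= -[x|c|f ts] l IH /=; rewrite !inE IH //.
by congr (_ || _); apply/eqP/eqP => [->|[]].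
Qed.

(** Positive arities give a complex argument some simple term [u]; the two nested applications above
    [u] put it at depth at least 2. *)
Lemma nesting_flat t : wf_term t -> nesting_depth t <= 1 -> flat t.
Proof.
case: t => // f ts wft nd /=; apply/allP => t' t'ts; apply/negP => ct'.
have wft' : wf_term t' by move: wft => /= /andP[_ /allP]; apply.
have [u ut'] : exists u, u \in simples t'.
  by have := simples_nil wft'; case: (simples t') => // u l _; exists u; rewrite inE eqxx.
have uts : u \in simples (TApp f ts).
  by apply/flattenP; exists (simples t') => //; apply: map_f.
have := @leq_bigmax_seq _ (simples (TApp f ts)) xpredT (fun u => depth u (TApp f ts)) u uts isT.
rewrite -/(nesting_depth _) => /leq_trans/(_ nd); rewrite leqNgt => /negP; apply.
rewrite /= ltnS; elim: ts t'ts {wft nd uts} => //= t ts IH.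
rewrite inE => /orP[/eqP <-|/IH lt].
  by rewrite ut' leq_max; case: t' ct' {wft' ut' IH}.
by case: ifP => //; rewrite leq_max lt orbT.
Qed.

Lemma flat_vars f ts X : flat (TApp f ts) -> (X \in vars (TApp f ts)) = (TVar X \in ts).
Proof.
rewrite simples_vars /=; elim: ts => //= t ts IH; case/andP=> ct /IH E.
by rewrite mem_cat E inE; case: t ct => //= *; rewrite !inE.
Qed.

Lemma flat_depth X t : flat t -> X \in vars t -> depth (TVar X) t = is_complex t.
Proof.
case: t => // f ts fl _ /=; congr S; elim: ts fl => //= t ts IH.
case/andP=> ct /IH ->; case: ifP => // _.
by case: t ct.
Qed.

Lemma subst_var t : subst (@TVar Sg) t = t.
Proof.
move: t; fix IH 1 => -[x|c|f ts] //=; congr TApp.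
by elim: ts => //= t ts ->; rewrite IH.
Qed.

Lemma height_subst_var s t X : flat t -> X \in vars t ->
  depth (TVar X) t + height (s X) <= height (subst s t).
Proof.
move=> fl Xt; rewrite (flat_depth fl Xt); case: t fl Xt => [Y|c|f ts] fl.
- by rewrite !inE => /eqP ->.
- by [].
rewrite (flat_vars _ fl) => Xts.
have := leqnn (height (subst s (TApp f ts))); rewrite {2}[height _]/= height_app.
by move/allP/(_ _ (map_f (subst s) Xts)).
Qed.

(** The bound on [is_complex t] accounts for the constants in [t], which the condition on variables
    does not see. *)
Lemma height_subst_le s t n : flat t -> is_complex t <= n ->
  (forall X, X \in vars t -> depth (TVar X) t + height (s X) <= n) ->
  height (subst s t) <= n.
Proof.
case: t => [Y|c|f ts] // fl; first by move=> _; apply; rewrite !inE.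
case: n => // n _ H.
rewrite [subst _ _]/= height_app; apply/allP => _ /mapP[t tts ->].
case: t tts => // [X Xts|g ts' /(allP fl)//].
have := H X; rewrite (flat_vars _ fl) => /(_ Xts).
by rewrite flat_depth ?flat_vars.
Qed.

Lemma arg_terms_subst s (A : atom Sg) :
  arg_terms (subst_atom s A) = [seq (x.1, subst s x.2) | x <- arg_terms A].
Proof.
rewrite /arg_terms /= size_map; set l := [seq _ | _ <- _].
by elim: l (aargs A) => [|x l IH] [|y m] //=; rewrite IH.
Qed.

Lemma mem_arg_terms (A : atom Sg) a t : (a, t) \in arg_terms A ->
  [/\ a.1 = apred A, a.2 < size (aargs A) & t \in aargs A].
Proof.
move=> aA; have sz : size [seq (apred A, i) | i <- iota 0 (size (aargs A))] = size (aargs A).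
  by rewrite size_map size_iota.
have := map_f fst aA; rewrite -/(unzip1 _) unzip1_zip ?sz //.
case/mapP=> i; rewrite mem_iota /= => ilt -> /=; split=> //.
by have := map_f snd aA; rewrite -/(unzip2 _) unzip2_zip ?sz.
Qed.

Lemma arg_terms_mem (A : atom Sg) t : t \in aargs A -> exists a, (a, t) \in arg_terms A.
Proof.
have sz : size [seq (apred A, i) | i <- iota 0 (size (aargs A))] = size (aargs A).
  by rewrite size_map size_iota.
have -> : aargs A = unzip2 (arg_terms A) by rewrite unzip2_zip ?sz.
by case/mapP=> -[a u] aA ->; exists a.
Qed.

Lemma body_arg_termsP (r : rule Sg) a u : (a, u) \in body_arg_terms r ->
  exists2 A, A \in rbody r & (a, u) \in arg_terms A.
Proof. by case/flattenP => _ /mapP[A Ar ->]; exists A. Qed.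

End Terms.

(** * Terms and arguments of the program *)

Section Program.
Variables (Sg : signature) (P : program Sg).
Hypotheses (wfP : wf_program P) (rrP : range_restricted P).
Hypotheses (onecP : one_complex_side P) (depthP : depth_at_most_one P).
Implicit Types (r : rule Sg) (a b : argument Sg) (A : atom Sg).

Lemma arg_rule_term r A a t : A \in rhead r :: rbody r ->
  (a, t) \in arg_terms A -> t \in rule_terms r.
Proof.
move=> Ar /mem_arg_terms[_ _ tA].
by apply/flattenP; exists (aargs A) => //; apply: map_f.
Qed.

Lemma rule_term_program r t : r \in P -> t \in rule_terms r ->
  t \in program_terms P.
Proof. by move=> rP tr; apply/flattenP; exists (rule_terms r); rewrite ?map_f. Qed.

Lemma rule_flat r t : r \in P -> t \in rule_terms r -> flat t.
Proof.
move=> rP tr; case: (boolP (is_complex t)) => [ct|]; last by case: (t).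
apply: nesting_flat (depthP rP tr ct); move: tr => /flattenP[_ /mapP[A Ar ->] tA].
move/allP: wfP => /(_ _ rP)/allP/(_ _ Ar)/andP[_ /allP]; exact.
Qed.

Lemma args_rule_atom r A a t : r \in P -> A \in rhead r :: rbody r ->
  (a, t) \in arg_terms A -> args P a.
Proof.
move=> rP Ar /mem_arg_terms[pa ia _]; split.
  rewrite pa; apply/flattenP; exists (map (@apred Sg) (rhead r :: rbody r)).
    by apply/mapP; exists r.
  exact: map_f.
move/allP: wfP => /(_ _ rP)/allP/(_ _ Ar)/andP[/eqP sz _].
by rewrite pa -sz.
Qed.

(** The finite list behind the maxima over arguments and the pigeonhole count. *)
Definition args_enum : seq (argument Sg) :=
  [seq (p, i) | p <- program_psyms P, i <- iota 0 (parity p)].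

Lemma mem_args_enum a : (a \in args_enum) <-> args P a.
Proof.
split.
  by case/allpairsPdep => p [i [pP]]; rewrite mem_iota => /= ip ->.
case: a => p i [/= pP ip]; apply/allpairsPdep; exists p, i.
by rewrite mem_iota.
Qed.

Lemma body_var r X : r \in P -> X \in head_vars r ->
  exists b u, (b, u) \in body_arg_terms r /\ X \in vars u.
Proof.
move=> rP /(rrP rP)/flattenP[_ /mapP[u /flattenP[_ /mapP[A Ar ->] uA] ->] Xu].
have [b bu] := arg_terms_mem uA; exists b, u; split=> //.
by apply/flattenP; exists (arg_terms A) => //; apply: map_f.
Qed.

Lemma head_var r a v X : (a, v) \in arg_terms (rhead r) -> X \in vars v ->
  X \in head_vars r.
Proof.
move=> /mem_arg_terms[_ _ vA] Xv.
by apply/flattenP; exists (vars v) => //; apply: map_f.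
Qed.

(** * The operator Omega and its monotonicity *)

Section MinD.
Variables (phi : argument Sg -> nat) (r : rule Sg) (t : term Sg) (X : var Sg).

Lemma minD_le b u : (b, u) \in body_arg_terms r -> X \in vars u ->
  (minD phi r t X <=
   (depth (TVar X) t)%:Z - (depth (TVar X) u)%:Z + (phi b)%:Z)%R.
Proof.
move=> bu Xu; rewrite /minD; set cands := [seq _ | _ <- _ & _].
apply: (@Order.TotalTheory.ge_bigmin_seq _ _ _ cands _ _ xpredT id) => //.
by apply/mapP; exists (b, u); rewrite // mem_filter Xu.
Qed.

(** The minimum of a nonempty list is attained because its unit is the head of the list; without
    candidates the unit is 0. *)
Lemma minD_mem :
  (minD phi r t X = 0%R /\
   forall b u, (b, u) \in body_arg_terms r -> X \notin vars u) \/
  (exists b u, [/\ (b, u) \in body_arg_terms r, X \in vars u &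
   minD phi r t X =
   ((depth (TVar X) t)%:Z - (depth (TVar X) u)%:Z + (phi b)%:Z)%R]).
Proof.
rewrite /minD; set cands := [seq _ | _ <- _ & _].
have mem_min (x : int) l :
    (\big[Order.min/x]_(z <- l) z)%R \in x :: l.
  elim: l => [|y l IH]; first by rewrite big_nil inE.
  rewrite big_cons /Order.min; case: ifP => _; first by rewrite !inE eqxx orbT.
  by move: IH; rewrite !inE => /orP[->//|->]; rewrite !orbT.
case E: cands => [|c0 cs] /=.
  left; split; first by rewrite big_nil.
  move=> b u bu; apply/negP => Xu; suff: false by [].
  have : (b, u) \in [seq qu <- body_arg_terms r | X \in vars qu.2].
    by rewrite mem_filter Xu.
  by move: E; rewrite /cands; case: [seq _ <- _ | _].
right; have : (\big[Order.min/c0]_(z <- cands) z)%R \in cands.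
  by have := mem_min c0 cands; rewrite inE => /orP[/eqP ->|//]; rewrite E inE eqxx.
rewrite -E => /mapP[[b u]]; rewrite mem_filter => /andP[/= Xu bu] eq.
by exists b, u.
Qed.

End MinD.

Lemma minD_mono phi phi' r t X : (forall b, phi b <= phi' b) ->
  (minD phi r t X <= minD phi' r t X)%R.
Proof.
move=> le; case: (minD_mem phi' r t X) => [[-> noX]|[b [u [bu Xu ->]]]].
  case: (minD_mem phi r t X) => [[-> _]//|[b [u [bu Xu _]]]].
  by have := noX _ _ bu; rewrite Xu.
have := minD_le phi t bu Xu; have := le b; lia.
Qed.

Lemma OmegaE phi a : Posz (Omega P phi a) =
   (\big[Order.max/0]_(r <- P)
    \big[Order.max/0]_(pt <- arg_terms (rhead r) | pt.1 == a)
    \big[Order.max/0]_(X <- vars pt.2) minD phi r pt.2 X)%R.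
Proof. by rewrite /Omega gez0_abs //; exact: Order.TotalTheory.bigmax_ge_id. Qed.

Lemma Omega_ge phi r a v X : r \in P -> (a, v) \in arg_terms (rhead r) ->
  X \in vars v -> (minD phi r v X <= (Omega P phi a)%:Z)%R.
Proof.
move=> rP av Xv; rewrite OmegaE.
apply: Order.TotalTheory.bigmax_sup_seq rP _ _ => //.
apply: Order.TotalTheory.bigmax_sup_seq av _ _ => //=.
exact: Order.TotalTheory.bigmax_sup_seq Xv _ _.
Qed.

Lemma Omega_mono phi phi' a : (forall b, phi b <= phi' b) ->
  Omega P phi a <= Omega P phi' a.
Proof.
move=> le; rewrite -lez_nat !OmegaE.
have max2 (x1 x2 y1 y2 : int) : (x1 <= x2 -> y1 <= y2 ->
    Order.max x1 y1 <= Order.max x2 y2)%R by lia.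
elim/big_ind2: _ => // [x1 x2 y1 y2|r _]; first exact: max2.
elim/big_ind2: _ => // [x1 x2 y1 y2|pt _]; first exact: max2.
elim/big_ind2: _ => // [x1 x2 y1 y2|X _]; first exact: max2.
exact: minD_mono.
Qed.

(** * Iterates of Omega inside and outside AR(P) *)

Let level k : argument Sg -> nat := iter k (Omega P) (fun=> 0).

Lemma level_leS k a : level k a <= level k.+1 a.
Proof. by elim: k a => [|k IH] a //; rewrite /level !iterS; apply: Omega_mono. Qed.

Lemma level_mono a : {homo level^~ a : k l / k <= l}.
Proof. exact: (homo_leq (@leqnn) leq_trans (fun k => level_leS k a)). Qed.

(** A nondecreasing sequence of naturals that reaches [n] and never exceeds it is constant from
    there on, which would put [a] in AR(P). *)
Lemma level_unbounded a n : args P a -> ~ AR P a -> exists K, n <= level K a.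
Proof.
move=> aP aAR; elim: n => [|n [K nK]]; first by exists 0.
apply: contrapT => bounded; apply: aAR; split=> //; exists K => k Kk.
apply/eqP; rewrite eqn_leq (level_mono _ Kk) andbT leqNgt; apply/negP => lt.
by apply: bounded; exists k; apply: leq_ltn_trans lt.
Qed.

Lemma eventually_all (T : eqType) (l : seq T) (Q : nat -> T -> Prop) :
  (forall x, x \in l -> exists K, forall k, K <= k -> Q k x) ->
  exists K, forall k x, K <= k -> x \in l -> Q k x.
Proof.
elim: l => [|y l IH] H; first by exists 0.
have [|K1 H1] := IH; first by move=> x xl; apply: H; rewrite inE xl orbT.
have [|K2 H2] := H y; first by rewrite inE eqxx.
exists (maxn K1 K2) => k x; rewrite geq_max => /andP[le1 le2].
by rewrite inE => /orP[/eqP ->|]; [apply: H2|apply: H1].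
Qed.

(* A late enough iterate of Omega is stable on AR(P) and so large elsewhere
   that the minimum D(r, i, X) is attained inside AR(P). *)
Lemma AR_levels : exists phi : argument Sg -> nat,
  forall r a v X, r \in P -> (a, v) \in arg_terms (rhead r) -> AR P a ->
  X \in vars v ->
  exists b u, [/\ (b, u) \in body_arg_terms r, X \in vars u, AR P b
                & depth (TVar X) v + phi b <= phi a + depth (TVar X) u].
Proof.
have [K stable] : exists K, forall k a, K <= k -> a \in args_enum ->
    AR P a -> level k a = level K a.
  have [a _|K H] := @eventually_all _ args_enum
     (fun k a => AR P a -> level k.+1 a = level k a).
    have [[_ [K H]]|nAR] := pselect (AR P a); last by exists 0.
    exists K => k Kk _; rewrite /level H; last exact: leqW.
    by rewrite [RHS]H.
  exists K => k a /subnKC <- aP aAR; elim: (k - K) => [|n IH]; first by rewrite addn0.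
  by rewrite addnS H ?leq_addr.
have [m mP] : exists m, forall a, a \in args_enum -> AR P a -> level K a <= m.
  exists (\max_(a <- args_enum) level K a) => a aP _.
  exact: (@leq_bigmax_seq _ args_enum xpredT (level K)).
(* From [L] on, levels outside AR(P) are at least m + 2, where [m] bounds the stable ones. Body
   terms are flat, so subtracting a depth removes at most 1, and a candidate from outside AR(P)
   exceeds [m]. *)
have [a /mem_args_enum aP|L large] := @eventually_all _ args_enum
     (fun k a => ~ AR P a -> m.+2 <= level k a).
  have [aAR|nAR] := pselect (AR P a); first by exists 0.
  have [L nL] := level_unbounded m.+2 aP nAR.
  by exists L => k Lk _; apply: leq_trans nL (level_mono _ Lk).
exists (level (maxn K L)) => r a v X rP av aAR Xv.
have hd : rhead r \in rhead r :: rbody r by rewrite inE eqxx.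
have aP : a \in args_enum by apply/mem_args_enum/(args_rule_atom rP hd av).
have := Omega_ge (level (maxn K L)) rP av Xv.
(* Past [K] the level is a fixed point of Omega on AR(P). *)
have -> : Omega P (level (maxn K L)) a = level (maxn K L) a.
  rewrite -[LHS]/(level (maxn K L).+1 a) stable //; last first.
    by rewrite leqW // leq_maxl.
  by rewrite [RHS]stable // leq_maxl.
have [[_ noX]|[b [u [bu Xu ->]]]] := minD_mem (level (maxn K L)) r v X; last first.
  move=> le; exists b, u; split=> //; last by lia.
  apply: contrapT => /(large _ _ (leq_maxr K L)).
  have [B Br buB] := body_arg_termsP bu.
  have Br' : B \in rhead r :: rbody r by rewrite inE Br orbT.
  move/(_ (proj2 (mem_args_enum _) (args_rule_atom rP Br' buB))).
  have := mP _ aP aAR; rewrite -(stable _ _ (leq_maxl K L) aP aAR).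
  have fu := rule_flat rP (arg_rule_term Br' buB).
  move: le; rewrite (flat_depth fu Xu); case: (is_complex u); lia.
have [b [u [bu Xu]]] := body_var rP (head_var av Xv).
by have := noX _ _ bu; rewrite Xu.
Qed.


(** * Induction on the minimum model and heights on AR(P) *)

Lemma minimum_model_ind (Q : atom Sg -> Prop) :
  (forall r s, r \in P -> minimum_model P (subst_atom s (rhead r)) ->
     (forall B, B \in rbody r -> Q (subst_atom s B)) ->
     Q (subst_atom s (rhead r))) ->
  forall A, minimum_model P A -> Q A.
Proof.
move=> Qind A MA; have [Mbase Mrule] := minimum_model_model wfP.
(* The atoms of the minimum model that satisfy [Q] form a Herbrand model, so minimality makes them
   all of it. *)
suff /minimum_model_min/(_ _ MA)[] : herbrand_model P [set A | minimum_model P A /\ Q A] by [].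
split=> [B [MB _]|r s rP gs body]; first exact: Mbase.
have Mhd : minimum_model P (subst_atom s (rhead r)) by apply: Mrule => // B /body[].
split=> //; apply: Qind => // B Br.
by case: (body (subst_atom s B)) => //; apply: map_f.
Qed.

Lemma subst_body_arg r s (Q : argument Sg -> term Sg -> Prop) :
  (forall B, B \in rbody r -> forall a t, (a, t) \in arg_terms (subst_atom s B) -> Q a t) ->
  forall b u, (b, u) \in body_arg_terms r -> Q b (subst s u).
Proof.
move=> body b u /body_arg_termsP[B Br buB]; apply: (body B Br).
by rewrite arg_terms_subst; apply/mapP; exists (b, u).
Qed.

Lemma AR_height : exists n, forall A a t, minimum_model P A ->
  (a, t) \in arg_terms A -> AR P a -> height t <= n.
Proof.
have [phi phiP] := AR_levels.
(* Heights at [a] are at most [phi a + 1]; the extra 1 is the height that a complex head term has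
   even without variables. *)
exists (\max_(a <- args_enum) (phi a).+1) => A a t MA aA aAR.
have [aP _] := aAR.
apply: (@leq_trans (phi a).+1); last first.
  exact: (@leq_bigmax_seq _ args_enum xpredT (fun a => (phi a).+1) _ (proj2 (mem_args_enum _) aP)).
move: A MA a t aA {aP} aAR.
apply: minimum_model_ind => r s rP _ /subst_body_arg IH a t.
rewrite arg_terms_subst => /mapP[[a' v] av [-> ->]] /= {a t} aAR.
have hd : rhead r \in rhead r :: rbody r by rewrite inE eqxx.
apply: (height_subst_le (rule_flat rP (arg_rule_term hd av))).
  by case: (is_complex v).
move=> X Xv; have [b [u [bu Xu bAR le]]] := phiP _ _ _ _ rP av aAR Xv.
have [B Br buB] := body_arg_termsP bu.
have fu : flat u.
  by apply: rule_flat rP (arg_rule_term _ buB); rewrite inE Br orbT.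
have := height_subst_var s fu Xu; have := IH _ _ bu bAR; lia.
Qed.

(** * Traces in the propagation graph and the pigeonhole argument *)

Section Trace.
Variable n : nat.

(* [trace a c]: a branch with symbols c can be transported to the argument a
   along the edges of the propagation graph, from a branch of length at most n;
   labels f push on c and labels \bar f pop from it. *)
Inductive trace : argument Sg -> seq (fsym Sg) -> Prop :=
| trace_short a c : size c <= n -> trace a c
| trace_eps e c : propagation_graph P e -> elab e = [::] ->
    trace (esrc e) c -> trace (edst e) c
| trace_sym e f c : propagation_graph P e -> elab e = [:: Sym f] ->
    f \in program_fsyms P -> trace (esrc e) c -> trace (edst e) (f :: c)
| trace_bar e f c : propagation_graph P e -> elab e = [:: Bar f] ->
    trace (esrc e) (f :: c) -> trace (edst e) c.

Lemma propagation_edge r X a v b u l : r \in P ->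
  (b, u) \in body_arg_terms r -> (a, v) \in arg_terms (rhead r) ->
  edge_label X u v l -> ~ AR P a -> propagation_graph P (Edge b a l).
Proof. by move=> rP bu av Xl aAR; split=> //; exists r, X, u, v. Qed.

Lemma program_fsyms_root r f vs : r \in P -> TApp f vs \in rule_terms r ->
  f \in program_fsyms P.
Proof.
move=> rP vr; apply/flattenP; exists (fsyms (TApp f vs)); last by rewrite inE eqxx.
exact: map_f (rule_term_program rP vr).
Qed.

(** Induction on derivations. A head variable receives its branch from a body term, through an edge
    \epsilon or \bar f; a complex head term pushes its root symbol onto the branch of one of its
    variables, through an edge f. *)
Lemma minimum_model_trace : 0 < n ->
  (forall A a t, minimum_model P A -> (a, t) \in arg_terms A -> AR P a ->
     height t <= n) ->
  forall A, minimum_model P A -> forall a t, (a, t) \in arg_terms A ->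
  forall c, branch c t -> trace a c.
Proof.
move=> n_gt0 ARn; apply: minimum_model_ind => r s rP Mhd /subst_body_arg IH a t at_hd c ct.
have [aAR|nAR] := pselect (AR P a).
  by apply: trace_short; apply: leq_trans (size_branch ct) (ARn _ _ _ Mhd at_hd aAR).
move: at_hd ct; rewrite arg_terms_subst => /mapP[[a' v] av [/= aE ->]] {t Mhd}.
subst a'.
have vr : v \in rule_terms r by apply: arg_rule_term av; rewrite inE eqxx.
have flv := rule_flat rP vr.
have body_flat b u : (b, u) \in body_arg_terms r -> flat u.
  case/body_arg_termsP => B Br /(arg_rule_term _) ur.
  by apply: (rule_flat rP); apply: ur; rewrite inE Br orbT.
case: v flv av vr => [X|k|f vs] flv av vr /=.
- move=> ct; have [|b [u [bu Xu]]] := @body_var r X rP.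
    by apply: head_var av _; rewrite inE.
  have tr := IH _ _ bu; have flu := body_flat _ _ bu.
  case: u flu bu Xu tr => [Y|k|f us] flu bu Xu tr.
  + move: Xu; rewrite inE => /eqP XY; subst Y.
    have G := propagation_edge rP bu av (label_eps X) nAR.
    exact: (trace_eps G) (tr _ ct).
  + by [].
  + have Xus : TVar X \in us by rewrite -(flat_vars _ flu).
    have G := propagation_edge rP bu av (label_bar f Xus) nAR.
    (* The branch [c] of [s X] extends to the branch [f :: c] of the body instance, from which the
       edge pops f. *)
    apply: (trace_bar G (erefl _)); apply: tr => /=; split=> //; right.
    by exists (s X) => //; apply: (map_f (subst s) Xus).
- by case: c => // _; apply: trace_short.
(* A branch stopping at the root, or at a constant just below it, has length 1 and is short by
   [n_gt0]. *)
case: c => [_|g c [-> [->|]]]; try exact: trace_short.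
move=> [_ /mapP[v' v'vs ->]].
have := allP flv v' v'vs; case: v' v'vs => // [X Xvs _ /= cX|k _ _]; last first.
  by case: c => // _; apply: trace_short.
have Xv : X \in vars (TApp f vs) by rewrite flat_vars.
have [b [u [bu Xu]]] := body_var rP (head_var av Xv).
(* The head term is complex and shares X with [u], so [u] is X itself and the edge is labelled f. *)
have ncu : ~~ is_complex u.
  have [B Br buB] := body_arg_termsP bu; have [_ _ uB] := mem_arg_terms buB.
  have [_ _ vA] := mem_arg_terms av.
  by have /= := onecP rP vA Br uB Xv Xu.
have tr := IH _ _ bu; case: u ncu Xu bu tr => // Y _.
rewrite inE => /eqP XY; subst Y => bu tr.
have G := propagation_edge rP bu av (label_sym f Xvs) nAR.
exact: (trace_sym G) (program_fsyms_root rP vr) (tr _ cX).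
Qed.

(** [pumps b b] is a cycle spelling a word of the language, the obstruction in the definition of
    GA(P). *)
Definition pumps b a : Prop := exists2 pi, path_from_to (propagation_graph P) b a pi
  & Gamma_language P (spelled pi).

Lemma pumps_trans c b a : pumps c b -> pumps b a -> pumps c a.
Proof.
move=> [pi p1 g1] [pi' p2 g2]; exists (pi ++ pi'); first exact: path_from_to_cat p2.
by rewrite spelled_cat; apply: gen_S_cat g1 (gen_S_S2 g2).
Qed.

(** With at least [n] symbols below it, [f] cannot belong to the short initial branch, so some edge
    [e] pushed it onto [c2]. It is not popped afterwards, and the rest of the path leaves exactly
    the symbols [c1] above it unmatched. *)
Lemma trace_opens a c : trace a c ->
  forall c1 f c2, c = c1 ++ f :: c2 -> n <= size c2 ->
  f \in program_fsyms P /\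
  exists e pi, [/\ elab e = [:: Sym f], trace (esrc e) c2,
     path_from_to (propagation_graph P) (esrc e) a (e :: pi)
   & opens (program_fsyms P) (spelled pi) c1].
Proof.
have extend (G := propagation_graph P) b e pi e' : G e' ->
    path_from_to G b (esrc e') (e :: pi) ->
    path_from_to G b (edst e') (e :: (pi ++ [:: e'])).
  by move=> Ge' p; apply: path_from_to_cat p (path_from_to_edge Ge').
have spell pi e' : spelled (pi ++ [:: e']) = spelled pi ++ elab e'.
  by rewrite spelled_cat /spelled /= cats0.
elim=> {a c} [a c cn|e' c Ge' le' _ IH|e' g c Ge' le' gP tr IH|e' g c Ge' le' _ IH] c1 f c2 E nc2.
- by move: cn; rewrite E size_cat /=; lia.
- have [fP [e [pi [lab_e tr p op]]]] := IH _ _ _ E nc2.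
  split=> //; exists e, (pi ++ [:: e']); split=> //; first exact: extend p.
  by rewrite spell le' cats0.
(* Either [e'] is itself the push of [f], or it pushes above [f]. *)
- case: c1 E => [|_ c1] [<-] E.
    rewrite -E; split=> //; exists e', [::]; split=> //.
    exact: opens_nil (gen_S1_nil _).
  have [fP [e [pi [lab_e tr' p op]]]] := IH _ _ _ E nc2.
  split=> //; exists e, (pi ++ [:: e']); split=> //; first exact: extend p.
  by rewrite spell le'; apply: opens_sym.
(* Before the pop, the symbols above [f] were [g :: c1]. *)
- have [fP [e [pi [lab_e tr' p op]]]] := IH (g :: c1) f c2 (congr1 _ E) nc2.
  split=> //; exists e, (pi ++ [:: e']); split=> //; first exact: extend p.
  by rewrite spell le'; apply: opens_bar op.
Qed.

(** The push of the top symbol, followed by an S2 word, fits the production S1 f S2 with S1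
    empty. *)
Lemma trace_pumps a f c : trace a (f :: c) -> n <= size c ->
  exists b, [/\ pumps b a, trace b c & args P b].
Proof.
move=> tr nc; have [fP [e [pi [lab_e tr' p op]]]] := trace_opens tr (erefl ([::] ++ f :: c)) nc.
exists (esrc e); split=> //.
  exists (e :: pi) => //; rewrite /spelled /= lab_e.
  exact: (gen_S_intro fP (gen_S1_nil _) (opens_S2 op)).
case: p => _ _ _ [[[r [X [u [v [rP bu _ _]]]]] _] _].
have [B Br buB] := body_arg_termsP bu.
by apply: args_rule_atom rP _ buB; rewrite inE Br orbT.
Qed.

Lemma trace_GA a c : GA P a -> trace a c -> size c <= n + size args_enum.
Proof.
move=> [_ noloop] tr; rewrite leqNgt; apply/negP => lt; apply: noloop.
suff [b [pi pb gb] [pi' pa _]] : exists2 b, pumps b b & pumps b a.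
  exists pi; split=> //; first by exists b.
  exists b; last by exists pi'.
  by case: pi pb {gb} => //= e pi [<- _ _ _]; rewrite inE eqxx.
have fresh V b : uniq V -> {subset V <= args_enum} -> args P b ->
    b \notin V -> size V < size args_enum.
  move=> uV VP bP bV; apply: (@uniq_leq_size _ (b :: V)); first by rewrite /= bV.
  by move=> x; rewrite inE => /orP[/eqP ->|/VP//]; apply/mem_args_enum.
(* [V] holds the distinct sources met before [b], and [d] is what remains of the stack. Each step
   pops one symbol of [d] and adds [b] to [V], so the sum of their sizes is kept; as long as [b] is
   fresh, the inequality leaves [d] longer than [n], and a source must repeat. *)
have step V b d : uniq V -> {subset V <= args_enum} -> pumps b a ->
    (forall x, x \in V -> pumps b x) -> args P b ->
    trace b d -> 
    n + size args_enum <= size d + size V ->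
    exists2 b, pumps b b & pumps b a.
  elim: d V b => [|f d IH] V b uV VP ba bV bP trb le.
    have [|/(fresh _ _ uV VP bP) sz] := boolP (b \in V); first by exists b => //; apply: bV.
    by have := leq_trans sz (leq_trans (leq_addl n _) le); rewrite ltnn.
  have [|bV'] := boolP (b \in V); first by exists b => //; apply: bV.
  have sz := fresh _ _ uV VP bP bV'.
  have [|b' [b'b trb' b'P]] := trace_pumps trb.
    rewrite -(leq_add2l n) in sz; move: (leq_trans sz le).
    by rewrite /= addnS addSn ltnS leq_add2r.
  apply: (IH (b :: V) b') => //=.
  - by rewrite bV'.
  - by move=> x; rewrite inE => /orP[/eqP ->|/VP//]; apply/mem_args_enum.
  - exact: pumps_trans b'b ba.
  - move=> x; rewrite inE => /orP[/eqP -> //|/bV]; exact: pumps_trans.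
  - by move: le; rewrite /= addnS addSn.
case: c tr lt => // f c tr lt.
have [|b [ba trb bP]] := trace_pumps tr; first by move: lt => /=; lia.
have [|b' [b'b trb' b'P]] := trace_pumps tr; first by move: lt => /=; lia.
by apply: (step [::] b c) => //; move: lt => /=; lia.
Qed.

End Trace.

Lemma GA_height : exists n, forall A a t, minimum_model P A ->
  (a, t) \in arg_terms A -> GA P a -> height t <= n.
Proof.
(* The successor makes the bound on short branches positive, as the traces require. *)
have [n nP] := AR_height; exists (n.+1 + size args_enum) => A a t MA aA aGA.
rewrite leqNgt; apply/negP => /height_branch[c ct sc].
have n1P B b u MB bB bAR := leqW (nP B b u MB bB bAR).
have := trace_GA aGA (minimum_model_trace (ltn0Sn n) n1P MA aA ct).
by rewrite sc ltnn.
Qed.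

(** * Finiteness of the minimum model *)

Fixpoint words (T : eqType) (l : seq T) k : seq (seq T) :=
  if k is k'.+1 then [seq x :: w | x <- l, w <- words l k'] else [:: [::]].

Lemma mem_words (T : eqType) (l : seq T) k (w : seq T) :
  size w = k -> {subset w <= l} -> w \in words l k.
Proof.
elim: k w => [|k IH] [|x w] //= [sz] wl.
apply: allpairs_f; first by apply: wl; rewrite inE eqxx.
by apply: IH => // y yw; apply: wl; rewrite inE yw orbT.
Qed.

Fixpoint universe n : seq (term Sg) :=
  map (@TCon Sg) (program_consts P) ++
  if n is n'.+1 then
    [seq TApp f ts | f <- program_fsyms P, ts <- words (universe n') (farity f)]
  else [::].

Lemma mem_universe n t : herbrand_universe P t -> height t <= n -> t \in universe n.
Proof.
elim: n t => [|n IH] _ [c cP|f ts fP sz tsP] //.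
- by move=> _; rewrite mem_cat map_f.
- by move=> _; rewrite mem_cat map_f.
rewrite height_app => /allP tsn; rewrite mem_cat; apply/orP; right.
apply/allpairsPdep; exists f, ts; split=> //.
by apply: mem_words => // t tts; apply: IH (tsP _ tts) (tsn _ tts).
Qed.

Lemma minimum_model_base A : minimum_model P A -> herbrand_base P A.
Proof. by have [+ _] := minimum_model_model wfP; apply. Qed.

Lemma GA_limited a : GA P a -> limited P a.
Proof.
move=> aGA; have [n nP] := GA_height.
apply: (@sub_finite_set _ _ [set` universe n]); last exact: finite_seq.
move=> t [A MA aA] /=; apply: mem_universe; last exact: nP aA aGA.
have [_ _ tA] := mem_arg_terms aA.
by have [_ _ +] := minimum_model_base MA; apply.
Qed.

Lemma Gamma_acyclic_finite_model : Gamma_acyclic P ->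
  exists l : seq (atom Sg), forall A, minimum_model P A -> A \in l.
Proof.
move=> GAP; have [n nP] := GA_height.
exists [seq Atom p ts | p <- program_psyms P, ts <- words (universe n) (parity p)].
move=> [p ts] MA; have [/= pP sz tsP] := minimum_model_base MA.
apply/allpairsPdep; exists p, ts; split=> //; apply: mem_words => // t tts.
apply: mem_universe; first exact: tsP.
have [a aA] := @arg_terms_mem _ (Atom p ts) t tts.
(* Acyclicity puts every argument in GA(P), where heights are bounded. *)
apply: (nP _ _ _ MA aA); rewrite GAP; have [/= ap ia _] := mem_arg_terms aA.
by split; rewrite ap //= -sz.
Qed.

(** * The intelligent instantiation inside the minimum model *)

Lemma minimum_model_rule r s : r \in P -> grounding P r s ->
  (forall B, B \in rbody r -> minimum_model P (subst_atom s B)) ->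
  minimum_model P (subst_atom s (rhead r)).
Proof.
move=> rP gs body; have [_ +] := minimum_model_model wfP; apply=> //.
by move=> _ /mapP[B Br ->]; apply: body.
Qed.

Lemma base_facts_model r : base_facts P r ->
  rbody r = [::] /\ minimum_model P (rhead r).
Proof.
move=> [rP /allP/(_ _ rP)]; rewrite eqxx => /andP[/nilP r0 /nilP v0]; split=> //.
(* A base fact has no variables, so the identity substitution grounds it. *)
have -> : rhead r = subst_atom (@TVar Sg) (rhead r).
  case: (rhead r) => p ts; congr Atom => /=.
  by rewrite -[LHS]map_id; apply: eq_map => t; rewrite subst_var.
apply: minimum_model_rule => // [X|B]; first by rewrite v0.
by rewrite r0.
Qed.

(** The invariant of the instantiation; with a finite minimum model, the condition on body lengths
    leaves finitely many such rules. *)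
Definition model_instance (g : rule Sg) : Prop :=
  [/\ minimum_model P (rhead g), forall B, B \in rbody g -> minimum_model P B
    & exists2 r, r \in P & size (rbody g) = size (rbody r)].

Lemma intelligent_instantiation_model Cs :
  intelligent_instantiation P Cs `<=` model_instance.
Proof.
rewrite /intelligent_instantiation.
have base : base_facts P `<=` model_instance.
  move=> r rB; have [r0 Mr] := base_facts_model rB; split=> //; last by exists r; case: rB.
  by rewrite r0.
have restr C S : S `<=` model_instance -> restricted_instances P C S `<=` model_instance.
  move=> SM _ [r [s [rP _ gs -> body]]].
  have Mbody B : B \in rbody (subst_rule s r) -> minimum_model P B.
    by move=> /body[g /SM[Mg _ _] <-].
  split=> //; last by exists r; rewrite //= size_map.
  apply: minimum_model_rule => // B Br; apply: Mbody; exact: map_f.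
(* The starting set is generalised, since each component enlarges it. *)
elim: Cs (base_facts P) base => //= C Cs IH S SM; apply: IH => g [/SM//|[k _]].
suff : iter k (fun X => X `|` restricted_instances P C (S `|` X)) set0 `<=` model_instance.
  by apply.
elim: k => //= k IHk h [/IHk//|]; apply: restr => h' [/SM//|/IHk//].
Qed.

Lemma Gamma_acyclic_finitely_ground : Gamma_acyclic P -> finitely_ground P.
Proof.
move=> /Gamma_acyclic_finite_model[l lP] Cs _.
pose inst := [seq Rule A B | A <- l, B <- flatten [seq words l (size (rbody r)) | r <- P]].
apply: (@sub_finite_set _ _ [set` inst]); last exact: finite_seq.
apply: subset_trans (@intelligent_instantiation_model Cs) _.
move=> [A B] [/= MA MB [r rP sz]]; apply: allpairs_f; first exact: lP.
apply/flattenP; exists (words l (size (rbody r))); first exact: map_f.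
by apply: mem_words => // D /MB/lP.
Qed.

End Program.

Theorem theorem1 (Sg : signature) (P : program Sg)
    (wfP : wf_program P)
    (rrP : range_restricted P)
    (onecP : one_complex_side P)
    (depthP : depth_at_most_one P) :
  (forall a : argument Sg, GA P a -> limited P a) /\
  (Gamma_acyclic P -> finitely_ground P).
Proof.
by split; [apply: GA_limited|apply: Gamma_acyclic_finitely_ground].
Qed.
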